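(* Let $n$ and $r$ be positive integers with $n\ge 3$ and $r$ odd. Then $$\operatorname{mr}^-\left(P_n^{(r)}\right) = \begin{cases} n-r & \text{if } 1 \le r \le n-3 \text{ and } n \text{ is odd},\\ n-r+1 & \text{if } 1 \le r \le n-3 \text{ and } n \text{ is even},\\ 2 & \text{if } r \ge n-2.\end{cases}$$
   Context: All graphs are simple (finite, loopless, undirected). For a graph $G$ on vertex set $\{1,\dots,n\}$, let $\mathcal{S}^-(G)$ be the set of real $n\times n$ skew-symmetric matrices $A=[a_{ij}]$ such that for $i\neq j$, $a_{ij}\neq 0$ if and only if $ij$ is an edge of $G$. The minimum skew rank of $G$ is $\operatorname{mr}^-(G)=\min\{\operatorname{rank}(A): A\in\mathcal{S}^-(G)\}$. $P_n$ denotes the path with vertex set $\{1,\dots,n\}$ where $ij$ is an edge iff $|i-j|=1$. For a positive integer $r$, the strict power $G^{(r)}$ is the simple graph on the same vertex set in which distinct vertices $i,j$ are adjacent iff there is a walk in $G$ from $i$ to $j$ of length exactly $r$ (walks may repeat vertices and edges). *)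

(* Defs.v *)
From mathcomp Require Import all_boot all_order all_algebra.
From mathcomp Require Import boolp reals.

Set Implicit Arguments.
Unset Strict Implicit.
Unset Printing Implicit Defensive.

Import GRing.Theory.
Local Open Scope ring_scope.

(* Vertices are labelled 0, ..., n-1 (type 'I_n) instead of 1, ..., n. *)
Record sgraph (n : nat) := SGraph {
  adj :> rel 'I_n;
  adj_sym : symmetric adj;
  adj_irr : irreflexive adj }.

Section MinSkewRank.
Variables (R : realType) (n : nat) (G : sgraph n).

Definition skew_mx (A : 'M[R]_n) : Prop :=
  A^T = - A /\ (forall i j : 'I_n, i != j -> A i j != 0 <-> G i j).

Lemma skew_mx_rank_ex :
  exists k : nat, `[< exists2 A : 'M[R]_n, skew_mx A & \rank A = k >].
Proof.
pose A : 'M[R]_n :=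
  \matrix_(i, j) (if G i j then (if (i < j)%N then 1 else -1) else 0).
exists (\rank A); apply/asboolP; exists A => //; split.
  apply/matrixP=> i j; rewrite !mxE adj_sym.
  case: ifP => Gij; last by rewrite oppr0.
  case: (ltngtP j i) => [||/val_inj jEi]; rewrite ?opprK //.
  by rewrite jEi adj_irr in Gij.
move=> i j _; rewrite mxE; case: ifP => _; last by rewrite eqxx.
by case: ifP; rewrite ?oppr_eq0 oner_neq0.
Qed.

Definition min_skew_rank : nat := ex_minn skew_mx_rank_ex.

End MinSkewRank.

Section Path.
Variable n : nat.

Definition path_rel : rel 'I_n := fun i j => `|(i : nat) - (j : nat)|%N == 1%N.

Lemma path_rel_sym : symmetric path_rel.
Proof. by move=> i j; rewrite /path_rel distnC. Qed.

Lemma path_rel_irr : irreflexive path_rel.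
Proof. by move=> i; rewrite /path_rel distnn. Qed.

Definition path_graph : sgraph n := SGraph path_rel_sym path_rel_irr.

End Path.

Section StrictPower.
Variables (n : nat) (G : sgraph n) (r : nat).

(* The tuple lists the r vertices following i in the walk. *)
Definition walk (i j : 'I_n) : bool :=
  [exists p : r.-tuple 'I_n, path G i p && (last i p == j)].

Definition strict_power_rel : rel 'I_n := fun i j => (i != j) && walk i j.

Lemma strict_power_sym : symmetric strict_power_rel.
Proof.
suff walk_sym i j : walk i j -> walk j i.
  by move=> i j; rewrite /strict_power_rel eq_sym; congr (_ && _);
     apply/idP/idP; apply: walk_sym.
case/existsP=> p /andP[Gp /eqP jE]; apply/existsP.
have sz : size (rev (belast i p)) == r by rewrite size_rev size_belast size_tuple.
exists (Tuple sz); rewrite /= -jE rev_path.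
rewrite (eq_path (e' := G)) ?Gp /=; last by move=> x y; rewrite /= adj_sym.
case: (tval p) => [|x s] //=.
by rewrite rev_cons last_rcons.
Qed.

Lemma strict_power_irr : irreflexive strict_power_rel.
Proof. by move=> i; rewrite /strict_power_rel eqxx. Qed.

Definition strict_power : sgraph n := SGraph strict_power_sym strict_power_irr.

End StrictPower.

(* Main.v *)
Require Import Defs.
From mathcomp Require Import all_boot all_order all_algebra.
From mathcomp Require Import boolp reals.
From mathcomp Require Import zify.

(** For r odd, vertices i, j of P_n^(r) are adjacent iff i + j is odd and
    |i - j| <= 2t + 1, where t = min((r-1)/2, floor(n/2) - 1), and the minimum
    skew rank is 2k with k = floor(n/2) - t.
    Upper bound: the graph is the union of the k complete bipartite graphs
    (even versus odd vertices) on the windows [2c, 2c + 2t + 2], c < k. Each one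
    carries a skew matrix of rank 2 with entries 1 at (even, odd); in the sum of
    these no cancellation occurs.
    Lower bound: in any A in S^-(G), the entries A(2a, 2(b + t) + 1), a, b < k,
    form a lower triangular matrix L with nonzero diagonal, and diag(L, -L^T)
    is a submatrix of A. *)

Set Implicit Arguments.
Unset Strict Implicit.
Unset Printing Implicit Defensive.

Import Order.TTheory GRing.Theory Num.Theory.

Lemma walk0 n (G : sgraph n) i j : walk G 0 i j = (i == j).
Proof.
apply/existsP/idP => [[p]|ij]; first by rewrite tuple0.
by exists [tuple]; rewrite /= ij.
Qed.

Lemma walkS n (G : sgraph n) r i j :
  walk G r.+1 i j = [exists k, G i k && walk G r k j].
Proof.
apply/existsP/existsP => [[p]|[k /andP[Gik /existsP[p Gp]]]].
  case/tupleP: p => k p /= /andP[/andP[Gik Gp] jE].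
  by exists k; rewrite Gik; apply/existsP; exists p; rewrite Gp.
by exists [tuple of k :: p]; rewrite /= Gik.
Qed.

(** Each step flips parity and moves by one; spare steps come in pairs and are spent going back and
    forth along an edge, which exists since [1 < n]. *)
Lemma walk_path_graph n r (i j : 'I_n) : 1 < n ->
  walk (path_graph n) r i j
  = (`|(i : nat) - (j : nat)| <= r) && (odd (i + j) == odd r).
Proof.
move=> n_gt1; elim: r i j => [|r IHr] i j.
  by rewrite walk0 -val_eqE /=; have := ltn_ord i; lia.
rewrite walkS; apply/existsP/idP => [[k]|ij].
  by rewrite IHr /= /path_rel; lia.
suff [k ltkn Pk] : exists2 k, k < n & [&& `|(i : nat) - k| == 1,
    `|k - (j : nat)| <= r & odd (k + j) == odd r].
  by exists (Ordinal ltkn); rewrite IHr /= /path_rel /=.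
have := ltn_ord i; have := ltn_ord j => ltj lti.
case: (ltngtP i j) => Hij.
- by exists i.+1; lia.
- by exists i.-1; lia.
(* Here [i = j], so [r] is odd, hence positive, and any neighbour of [i] will do. *)
case: (ltnP i.+1 n) => lti1; first by exists i.+1; lia.
by exists i.-1; lia.
Qed.

Lemma strict_power_path n r (i j : 'I_n) : 1 < n -> odd r ->
  strict_power (path_graph n) r i j
  = odd (i + j) && (`|(i : nat) - (j : nat)| <= r).
Proof.
move=> n_gt1 odd_r; rewrite /= /strict_power_rel walk_path_graph // odd_r.
rewrite -val_eqE /=; lia.
Qed.

Section SkewRank.
Local Open Scope ring_scope.

Lemma min_skew_rank_eq (R : realType) n (G : sgraph n) k :
  (exists2 A : 'M[R]_n, skew_mx G A & (\rank A <= k)%N) ->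
  (forall A : 'M[R]_n, skew_mx G A -> (k <= \rank A)%N) ->
  min_skew_rank R G = k.
Proof.
move=> [A skA leAk] lek; rewrite /min_skew_rank.
case: ex_minnP => m /asboolP[B skB <-] min_m.
apply/eqP; rewrite eqn_leq lek // andbT.
by apply: leq_trans leAk; apply: min_m; apply/asboolP; exists A.
Qed.

Lemma mxrank_mxsub (F : fieldType) m n p q (f : 'I_p -> 'I_m)
    (g : 'I_q -> 'I_n) (A : 'M[F]_(m, n)) :
  (\rank (mxsub f g A) <= \rank A)%N.
Proof.
rewrite -[A in mxsub _ _ A]mulmx1 mxsub_mul rowsubE -mulmxA.
by apply: leq_trans (mxrankM_maxr _ _) (mxrankM_maxl _ _).
Qed.

Lemma mxrank_trig (F : fieldType) n (L : 'M[F]_n) :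
  is_trig_mx L -> (forall i, L i i != 0) -> \rank L = n.
Proof.
move=> trigL L_neq0; apply: mxrank_unit.
by rewrite unitmxE det_trig // unitfE; apply/prodf_neq0.
Qed.

Section PathPowerRank.
Variables (R : realType) (n t : nat) (G : sgraph n).
Hypothesis lttn : (t < n./2)%N.
Hypothesis adjG : forall i j : 'I_n,
  G i j = (odd (i + j) && (`|(i : nat) - (j : nat)| <= t.*2.+1))%N.
Let k := (n./2 - t)%N.

Definition window_mx (b : bool) : 'M[R]_(n, k) :=
  \matrix_(i, c) ((odd i == b) && (c.*2 <= i <= c.*2 + t.*2.+2)%N)%:R.

Lemma skew_mx_low_rank :
  exists2 A : 'M[R]_n, skew_mx G A & (\rank A <= k.*2)%N.
Proof.
pose P := window_mx false; pose Q := window_mx true.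
exists (P *m Q^T - Q *m P^T); last first.
  rewrite -addnn; apply: leq_trans (mxrank_add _ _) _.
  rewrite eqmx_opp.
  by apply: leq_add; apply: leq_trans (mxrankM_maxl _ _) (rank_leq_col _).
split=> [|i j _]; first by rewrite linearB /= !trmx_mul !trmxK opprB.
(* [N] counts the windows containing both [i] and [j]. Entries at opposite parities are [N] up to
   sign, nonzero in characteristic 0 once one window contains both. *)
pose N := (\sum_(c < k) ((c.*2 <= i <= c.*2 + t.*2.+2)
  && (c.*2 <= j <= c.*2 + t.*2.+2)))%N.
have entry b b' : (window_mx b *m (window_mx b')^T) i j
    = ((odd i == b) && (odd j == b'))%:R * N%:R.
  rewrite mxE natr_sum mulr_sumr; apply: eq_bigr => c _.
  by rewrite !mxE -!natrM !mulnb andbACA.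
have N_gt0 : ((0 < N) = [exists c : 'I_k, (c.*2 <= i <= c.*2 + t.*2.+2)
    && (c.*2 <= j <= c.*2 + t.*2.+2)])%N.
  rewrite lt0n sum_nat_eq0 negb_forall; apply: eq_existsb => c.
  by rewrite eqb0 negbK.
have -> : (P *m Q^T - Q *m P^T) i j
    = (P *m Q^T) i j - (Q *m P^T) i j by rewrite !mxE.
rewrite !entry adjG oddD.
have lti := ltn_ord i; have ltj := ltn_ord j.
case odd_i: (odd i); case odd_j: (odd j);
  rewrite /= ?mul0r ?mul1r ?sub0r ?subr0 ?oppr_eq0 ?eqxx // pnatr_eq0 -lt0n N_gt0;
  (split=> [/existsP[c]|ij]; first by lia);
  (suff [c ltck Pc] : exists2 c, (c < k)%N & ((c.*2 <= i <= c.*2 + t.*2.+2)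
    && (c.*2 <= j <= c.*2 + t.*2.+2))%N by apply/existsP; exists (Ordinal ltck));
  (* The window starting at the smaller vertex rounded down to even; the cap [k.-1] is safe because
     the last window ends at [n./2.*2], which is at least [n - 1]. *)
  by exists (minn k.-1 (minn i j)./2); rewrite /k; lia.
Qed.

Lemma skew_mx_rank_ge (A : 'M[R]_n) : skew_mx G A -> (k.*2 <= \rank A)%N.
Proof.
move=> [trA GA].
have A0 i j : ~~ G i j -> A i j = 0.
  have [<- _|neq_ij nGij] := eqVneq i j.
    move/matrixP/(_ i i)/eqP: trA; rewrite !mxE -addr_eq0 -mulr2n.
    by rewrite mulrn_eq0 /= => /eqP.
  by apply/eqP; apply: contraNT nGij => /(GA i j neq_ij).
have lt_e (a : 'I_k) : (a.*2 < n)%N by have := ltn_ord a; rewrite /k; lia.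
have lt_o (a : 'I_k) : ((a + t).*2.+1 < n)%N.
  by have := ltn_ord a; rewrite /k; lia.
pose e a := Ordinal (lt_e a); pose o a := Ordinal (lt_o a).
pose L := mxsub e o A.
have rkL : \rank L = k.
  apply: mxrank_trig => [|a].
    (* The distance from [e a] to [o b] is at least [2t + 3] for [a < b], and exactly [2t + 1] for
       [a = b]. *)
    by apply/is_trig_mxP => a b ltab; rewrite mxE A0 // adjG /=; lia.
  by rewrite mxE; apply/GA; rewrite -?val_eqE ?adjG /=; lia.
(* Rows and columns list the two parities in opposite orders, which puts [L] on the diagonal; the
   off-diagonal blocks join vertices of equal parity. *)
pose f x := match split x with inl a => e a | inr a => o a end.
pose g x := match split x with inl a => o a | inr a => e a end.
suff subA : mxsub f g A = block_mx L 0 0 (- L^T).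
  apply: leq_trans (mxrank_mxsub f g A).
  by rewrite subA rank_diag_block_mx eqmx_opp mxrank_tr rkL addnn.
apply/matrixP=> x y; rewrite !mxE /f /g.
case: (split x) => a; rewrite !mxE; case: (split y) => b; rewrite ?mxE //.
- by rewrite A0 // adjG /=; lia.
- by rewrite A0 // adjG /=; lia.
by move/matrixP/(_ (o a) (e b)): trA; rewrite !mxE => ->; rewrite opprK.
Qed.

Lemma path_power_rank : min_skew_rank R G = k.*2.
Proof. exact: min_skew_rank_eq skew_mx_low_rank skew_mx_rank_ge. Qed.

End PathPowerRank.

End SkewRank.

Theorem mainTheorem3 (R : realType) (n r : nat) (hn : 3 <= n) (hr0 : 0 < r)
    (hr : odd r) :
  [/\ 1 <= r <= n - 3 -> odd n ->
        min_skew_rank R (strict_power (path_graph n) r) = n - r,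
      1 <= r <= n - 3 -> ~~ odd n ->
        min_skew_rank R (strict_power (path_graph n) r) = n - r + 1
    & n - 2 <= r ->
        min_skew_rank R (strict_power (path_graph n) r) = 2].
Proof.
(* The cap loses no edge: [2 * n./2 - 1] is the largest odd distance in the path. *)
pose t := minn r./2 n./2.-1.
have rankE : min_skew_rank R (strict_power (path_graph n) r) = (n./2 - t).*2.
  apply: path_power_rank => [|i j]; first by rewrite /t; lia.
  rewrite strict_power_path //; last by lia.
  by have := ltn_ord i; have := ltn_ord j; rewrite /t; lia.
by rewrite rankE /t; split; lia.
Qed.
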